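(* Let $q$ be a prime power. Let $K^{\mathrm{Px}}:=\bigcup_{n\in\mathbb{N}}\mathbb{F}_{q}((t^{1/n}))$ and $\mathcal{O}^{\mathrm{Px}}:=\bigcup_{n\in\mathbb{N}}\mathbb{F}_{q}[[t^{1/n}]]$. Then $\mathcal{O}^{\mathrm{Px}}$ is $\exists$-$\emptyset$-definable in $K^{\mathrm{Px}}$.
   Context: $\mathbb{F}_{q}$ is the finite field with $q$ elements, and $(t^{1/n})_{n\in\mathbb{N}}$ (with $n\geq 1$) is a compatible system of $n$-th roots of $t$, i.e. $(t^{1/(mn)})^{m}=t^{1/n}$ for all $m,n\geq1$ and $t^{1/1}=t$. The field $K^{\mathrm{Px}}$ of Puiseux series over $\mathbb{F}_{q}$ is formally the direct limit of the fields $\mathbb{F}_{q}((t^{1/n}))$ along the natural inclusions (ordered by divisibility of $n$), and $\mathcal{O}^{\mathrm{Px}}$ is the valuation ring of the $t$-adic valuation on $K^{\mathrm{Px}}$ (whose value group is $\mathbb{Q}$). A subset of a field $L$ is $\exists$-$\emptyset$-definable if it is the set of elements of $L$ satisfying some existential first-order formula in one free variable in the language of rings $\mathcal{L}_{\mathrm{ring}}$, without parameters. *)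

(* Defs.v *)
From HB Require Import structures.
From mathcomp Require Import all_boot all_order all_algebra.
From mathcomp Require Import boolp classical_sets functions fsbigop.

Set Implicit Arguments.
Unset Strict Implicit.
Unset Printing Implicit Defensive.

Import Order.TTheory GRing.Theory Num.Theory.

Local Open Scope classical_set_scope.
Local Open Scope ring_scope.

(* A library formula over L may contain constants of L, inverses and "Unit"   *)
(* atoms: [GRing.rformula] excludes the last two, [param_free] the first.     *)

Section Definability.

Variable L : Type.
Implicit Types (t : GRing.term L) (f : GRing.formula L).

Fixpoint param_free_term t : bool :=
  match t with
  | GRing.Var _ | GRing.NatConst _ => true
  | GRing.Const _ => false
  | GRing.Add t1 t2 | GRing.Mul t1 t2 =>
      param_free_term t1 && param_free_term t2
  | GRing.Opp t1 | GRing.NatMul t1 _ | GRing.Inv t1 | GRing.Exp t1 _ =>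
      param_free_term t1
  end.

Fixpoint param_free f : bool :=
  match f with
  | GRing.Bool _ => true
  | GRing.Equal t1 t2 => param_free_term t1 && param_free_term t2
  | GRing.Unit t1 => param_free_term t1
  | GRing.And f1 f2 | GRing.Or f1 f2 | GRing.Implies f1 f2 =>
      param_free f1 && param_free f2
  | GRing.Not f1 | GRing.Exists _ f1 | GRing.Forall _ f1 => param_free f1
  end.

Fixpoint term_vars t : seq nat :=
  match t with
  | GRing.Var i => [:: i]
  | GRing.Const _ | GRing.NatConst _ => [::]
  | GRing.Add t1 t2 | GRing.Mul t1 t2 => term_vars t1 ++ term_vars t2
  | GRing.Opp t1 | GRing.NatMul t1 _ | GRing.Inv t1 | GRing.Exp t1 _ =>
      term_vars t1
  end.

Fixpoint free_vars f : seq nat :=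
  match f with
  | GRing.Bool _ => [::]
  | GRing.Equal t1 t2 => term_vars t1 ++ term_vars t2
  | GRing.Unit t1 => term_vars t1
  | GRing.And f1 f2 | GRing.Or f1 f2 | GRing.Implies f1 f2 =>
      free_vars f1 ++ free_vars f2
  | GRing.Not f1 => free_vars f1
  | GRing.Exists i f1 | GRing.Forall i f1 =>
      [seq j <- free_vars f1 | j != i]
  end.

End Definability.

Fixpoint existential (L : unitRingType) (f : GRing.formula L) : bool :=
  match f with
  | GRing.Exists _ f1 => existential f1
  | _ => GRing.qf_form f
  end.

Definition ex_emptyset_definable (L : fieldType) (A : set L) : Prop :=
  exists f : GRing.formula L,
    [/\ existential f, GRing.rformula f, param_free f,
        all (pred1 0%N) (free_vars f)
      & A = [set x | GRing.holds [:: x] f]].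

(* Puiseux series over F are represented by their coefficient functions       *)
(* rat -> F, the value at r being the coefficient of t^r; t^(1/n) is thus the *)
(* indicator function of 1/n, which makes the chosen roots of t compatible    *)
(* and turns the natural inclusions of the F((t^(1/n))) into identities.      *)

Section Series.

Variable F : fieldType.
Implicit Types (f g h : rat -> F) (n d : nat) (m : int).

Definition grid n m (k : nat) : rat := (m + k%:Z)%:~R / n%:R.

(* f = \sum_(k >= 0) a_k t^((m + k) / n) for some coefficients a_k. *)
Definition series_from n m f : Prop :=
  forall r, f r != 0 -> exists k, r = grid n m k.

Definition laurent n f : Prop := exists m, series_from n m f.

Definition power_series n f : Prop := series_from n 0 f.

Definition puiseux_series : {pred rat -> F} :=
  fun f => `[< exists2 n, (0 < n)%N & laurent n f >].

(* The sum is finite on Puiseux series, see [grid_convE]. *)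
Definition conv f g : rat -> F :=
  fun r => \sum_(a \in [set: rat]) f a * g (r - a).

Lemma grid_inj n m : (0 < n)%N -> injective (grid n m).
Proof.
move=> n0 i j /(congr1 (fun x => x * n%:R)).
rewrite !divfK ?pnatr_eq0 -?lt0n// => /eqP.
by rewrite eqr_int => /eqP/addrI[].
Qed.

Lemma gridD n m m' i j : grid n m i + grid n m' j = grid n (m + m') (i + j).
Proof. by rewrite /grid -mulrDl -intrD PoszD addrACA. Qed.

Lemma series_from_shift n m m' f :
  m' <= m -> series_from n m f -> series_from n m' f.
Proof.
move=> lem fS r /fS[k ->]; exists (`|m - m'| + k)%N; rewrite /grid PoszD.
by rewrite gez0_abs ?subr_ge0// addrA [m' + _]addrC subrK.
Qed.

Lemma series_from_refine n d m f : (0 < d)%N ->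
  series_from n m f -> series_from (n * d) (m * d%:Z) f.
Proof.
move=> d0 fS r /fS[k ->]; exists (k * d)%N; rewrite /grid PoszM -mulrDl.
have d0' : d%:R != 0 :> rat by rewrite pnatr_eq0 -lt0n.
by rewrite intrM natrM -[d%:~R]/(d%:R) -mulf_div divff// mulr1.
Qed.

Lemma series_ext n m f g : series_from n m f -> series_from n m g ->
  (forall k, f (grid n m k) = g (grid n m k)) -> f = g.
Proof.
move=> fS gS fg; apply/funext => r.
have [fr|/fS[k ->]//] := eqVneq (f r) 0.
have [gr|/gS[k ->]//] := eqVneq (g r) 0.
by rewrite fr gr.
Qed.

Lemma puiseuxP2 f g : f \in puiseux_series -> g \in puiseux_series ->
  exists n m m', [/\ (0 < n)%N, series_from n m f & series_from n m' g].
Proof.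
move=> /asboolP[n n0 [m fS]] /asboolP[n' n'0 [m' gS]].
exists (n * n')%N, (m * n'%:Z), (m' * n%:Z); split; first by rewrite muln_gt0 n0.
  exact: series_from_refine.
by rewrite mulnC; apply: series_from_refine.
Qed.

Lemma series_from_puiseux n m f :
  (0 < n)%N -> series_from n m f -> f \in puiseux_series.
Proof. by move=> n0 fS; apply/asboolP; exists n => //; exists m. Qed.

Lemma series_from_conv n m m' f g : series_from n m f -> series_from n m' g ->
  series_from n (m + m') (conv f g).
Proof.
move=> fS gS r /(@fsbigN1 _ _ _ _ _ _ (fun r a => f a * g (r - a)))[a _].
rewrite mulf_eq0 negb_or => /andP[/fS[i ai]].
move=> /gS[j /eqP]; rewrite subr_eq ai addrC gridD => /eqP ->.
by exists (i + j)%N.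
Qed.

Lemma grid_convE n m m' f g k : (0 < n)%N ->
  series_from n m f -> series_from n m' g ->
  conv f g (grid n (m + m') k) =
    \sum_(i < k.+1) f (grid n m i) * g (grid n m' (k - i)).
Proof.
move=> n0 fS gS; rewrite /conv.
rewrite (@fsbigE _ _ _ _ _ [seq grid n m i | i <- iota 0 k.+1])//; last 2 first.
- by rewrite map_inj_uniq ?iota_uniq//; exact: grid_inj.
- move=> a _ anot; apply/eqP; apply: contraNT anot.
  rewrite mulf_eq0 negb_or => /andP[/fS[i ->]] /gS[j /eqP].
  rewrite subr_eq addrC gridD => /eqP/(grid_inj n0) ->.
  by apply: map_f; rewrite mem_iota/= add0n ltnS leq_addl.
rewrite big_map -[iota 0 k.+1]/(index_iota 0 k.+1) big_mkcond/= big_mkord.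
apply: eq_bigr => i _; rewrite in_setT; congr (_ * g _).
by apply/eqP; rewrite subr_eq gridD [m' + m]addrC subnK// -ltnS ltn_ord.
Qed.

Lemma puiseux_conv f g : f \in puiseux_series -> g \in puiseux_series ->
  conv f g \in puiseux_series.
Proof.
move=> /puiseuxP2/[apply] -[n [m [m' [n0 fS gS]]]].
exact/(series_from_puiseux n0)/(series_from_conv fS gS).
Qed.

Lemma puiseuxD f g : f \in puiseux_series -> g \in puiseux_series ->
  f + g \in puiseux_series.
Proof.
move=> /puiseuxP2/[apply] -[n [m [m' [n0 fS gS]]]].
apply: (@series_from_puiseux n (Num.min m m')) => // r; rewrite fctE.
have [fr|fr _] := eqVneq (f r) 0; last first.
  by apply: (series_from_shift _ fS fr); rewrite ge_min lexx.
rewrite fr add0r => gr.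
by apply: (series_from_shift _ gS gr); rewrite ge_min lexx orbT.
Qed.

Lemma puiseux_zmod_closed : zmod_closed puiseux_series.
Proof.
split=> [|f g fP gP].
  by apply: (@series_from_puiseux 1 0) => // r; rewrite eqxx.
apply: puiseuxD fP _; move/asboolP : gP => [n n0 [m gS]].
by apply: (@series_from_puiseux n m) => // r; rewrite oppr_eq0; exact: gS.
Qed.

HB.instance Definition _ :=
  GRing.isZmodClosed.Build (rat -> F) puiseux_series puiseux_zmod_closed.

Definition one_series : rat -> F := fun r => (r == 0)%:R.

Lemma one_seriesS n : series_from n 0 one_series.
Proof.
move=> r; rewrite /one_series; have [-> _|_] := eqVneq r 0; last by rewrite eqxx.
by exists 0%N; rewrite /grid addr0 mul0r.
Qed.

Lemma one_series_grid n k : (0 < n)%N -> one_series (grid n 0 k) = (k == 0%N)%:R.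
Proof.
move=> n0; rewrite /one_series -(inj_eq (@grid_inj n 0 n0)).
by congr ((_ == _)%:R); rewrite /grid addr0 mul0r.
Qed.

Lemma convC f g : f \in puiseux_series -> g \in puiseux_series ->
  conv f g = conv g f.
Proof.
move=> /puiseuxP2/[apply] -[n [m [m' [n0 fS gS]]]].
apply: (series_ext (series_from_conv fS gS)) => [|k].
  by rewrite addrC; exact: series_from_conv.
rewrite grid_convE// [m + m']addrC grid_convE//.
rewrite (reindex_inj rev_ord_inj)/=; apply: eq_bigr => i _.
by rewrite mulrC subSS subKn// -ltnS ltn_ord.
Qed.

Lemma convA f g h : f \in puiseux_series -> g \in puiseux_series ->
  h \in puiseux_series -> conv f (conv g h) = conv (conv f g) h.
Proof.
move=> /puiseuxP2/[apply] -[n [m1 [m2 [n0 fS gS]]]] /asboolP[d d0 [m3 hS]].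
have {n0 d0 fS gS hS} [n0 [fS gS hS]] : (0 < n * d)%N /\
  [/\ series_from (n * d) (m1 * d%:Z) f, series_from (n * d) (m2 * d%:Z) g
    & series_from (n * d) (m3 * n%:Z) h].
  split; first by rewrite muln_gt0 n0.
  by split; [| |rewrite mulnC]; exact: series_from_refine.
move: (n * d)%N (m1 * _) (m2 * _) (m3 * _) n0 fS gS hS => {d m1 m2 m3}.
move=> {}n m1 m2 m3 n0 fS gS hS.
have fgS := series_from_conv fS gS; have ghS := series_from_conv gS hS.
apply: (series_ext (series_from_conv fS ghS)) => [|k].
  by rewrite addrA; exact: series_from_conv.
rewrite grid_convE// addrA grid_convE//.
pose P f m : {poly F} := \poly_(i < k.+1) f (grid n m i).
have PE f' m i : (i <= k)%N -> (P f' m)`_i = f' (grid n m i).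
  by move=> ik; rewrite coef_poly ltnS ik.
transitivity ((P f m1 * (P g m2 * P h m3))`_k).
  rewrite coefM; apply: eq_bigr => i _.
  have ik : (i <= k)%N by rewrite -ltnS ltn_ord.
  rewrite PE// grid_convE// coefM; congr (_ * _); apply: eq_bigr => j _.
  have jk : (j <= k - i)%N by rewrite -ltnS ltn_ord.
  rewrite !PE//; first exact/(leq_trans (leq_subr _ _))/leq_subr.
  exact/(leq_trans jk)/leq_subr.
rewrite mulrA coefM; apply: eq_bigr => i _.
have ik : (i <= k)%N by rewrite -ltnS ltn_ord.
rewrite [in (P h _)`__]PE ?leq_subr// grid_convE// coefM.
congr (_ * _); apply: eq_bigr => j _.
have jk : (j <= i)%N by rewrite -ltnS ltn_ord.
by rewrite !PE// (leq_trans _ ik)// leq_subr.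
Qed.

Lemma conv1 f : f \in puiseux_series -> conv one_series f = f.
Proof.
move=> /asboolP[n n0 [m fS]]; have oS := @one_seriesS n.
apply: (series_ext (n := n) (m := 0 + m)) => [||k].
- exact: series_from_conv.
- by rewrite add0r.
rewrite grid_convE// add0r big_ord_recl big1 ?addr0/=.
  by rewrite one_series_grid// mul1r subn0.
by move=> i _; rewrite one_series_grid// mul0r.
Qed.

Lemma convDl f g h : f \in puiseux_series -> g \in puiseux_series ->
  h \in puiseux_series -> conv (f + g) h = conv f h + conv g h.
Proof.
move=> fP gP /asboolP[d d0 [m3 hS]].
have [n [m1 [m2 [n0 fS gS]]]] := puiseuxP2 fP gP.
have {m1 m2 fS gS} [m [fS gS]] :
    exists m, series_from n m f /\ series_from n m g.
  exists (Num.min m1 m2); split.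
    by apply: series_from_shift fS; rewrite ge_min lexx.
  by apply: series_from_shift gS; rewrite ge_min lexx orbT.
have {n0 d0 fS gS hS} [n0 [fS gS hS]] : (0 < n * d)%N /\
  [/\ series_from (n * d) (m * d%:Z) f, series_from (n * d) (m * d%:Z) g
    & series_from (n * d) (m3 * n%:Z) h].
  split; first by rewrite muln_gt0 n0.
  by split; [| |rewrite mulnC]; exact: series_from_refine.
move: (n * d)%N (m * _) (m3 * _) n0 fS gS hS => {d m m3}.
move=> {}n m m3 n0 fS gS hS.
have DS f' g' l : series_from n l f' -> series_from n l g' ->
    series_from n l (f' + g').
  move=> fS' gS' r; rewrite fctE.
  by have [->|/fS'//] := eqVneq (f' r) 0; rewrite add0r; exact: gS'.
have fgS := DS _ _ _ fS gS.
apply: (series_ext (n := n) (m := m + m3)) => [||k].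
- exact: series_from_conv.
- by apply: DS; exact: series_from_conv.
rewrite [in RHS]fctE !grid_convE// -big_split/=.
by apply: eq_bigr => i _; rewrite fctE mulrDl.
Qed.

(* The first k coefficients of the inverse of \sum_i a_i X^i. *)
Fixpoint inv_coefs (a : nat -> F) k : seq F :=
  if k is j.+1 then
    let s := inv_coefs a j in
    rcons s ((a 0%N)^-1 *
      ((j == 0%N)%:R - \sum_(i < j) a i.+1 * s`_(j - i.+1)))
  else [::].

Lemma size_inv_coefs a k : size (inv_coefs a k) = k.
Proof. by elim: k => //= k IH; rewrite size_rcons IH. Qed.

Lemma nth_inv_coefs a k j : (j < k)%N ->
  (inv_coefs a k)`_j = (inv_coefs a j.+1)`_j.
Proof.
elim: k => // k IH; rewrite ltnS leq_eqVlt => /predU1P[->//|jk].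
by rewrite /= nth_rcons size_inv_coefs jk IH.
Qed.

Lemma inv_coefsE a k : a 0%N != 0 ->
  \sum_(i < k.+1) a i * (inv_coefs a (k - i).+1)`_(k - i) = (k == 0%N)%:R.
Proof.
move=> a0; rewrite big_ord_recl subn0 [inv_coefs a k.+1]/=.
rewrite nth_rcons size_inv_coefs ltnn eqxx mulVKf// -addrA.
rewrite [X in _ + X](_ : _ = 0) ?addr0// addrC; apply/eqP.
rewrite subr_eq0; apply/eqP/eq_bigr => i _.
by rewrite lift0 [in RHS]nth_inv_coefs// ltn_subrL /= (leq_ltn_trans _ (ltn_ord i)).
Qed.

Lemma conv_inv_ex f : f \in puiseux_series -> f != 0 ->
  exists2 g, g \in puiseux_series & conv g f = one_series.
Proof.
move=> fP f0; have /asboolP[n n0 [m fS]] := fP.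
have [k0 fk0] : exists k, f (grid n m k) != 0.
  apply: contrapT => fgrid0; move/eqP: f0; apply; apply/funext => r.
  have [//|fr] := eqVneq (f r) 0; case: fgrid0.
  by have [k rk] := fS _ fr; exists k; rewrite -rk.
have [k fk kmin] := ex_minnP (ex_intro (fun k => f (grid n m k) != 0) k0 fk0).
have gridS j : grid n (m + k%:Z) j = grid n m (k + j).
  by rewrite /grid PoszD addrA.
have {}fS : series_from n (m + k%:Z) f.
  move=> r /[dup] fr /fS[j rj]; exists (j - k)%N; rewrite gridS subnKC//.
  by apply: kmin; rewrite -rj.
move: (m + k%:Z) fS gridS => m' fS gridS.
pose a j := f (grid n m' j).
have a0 : a 0%N != 0 by rewrite /a gridS addn0.
pose b j := (inv_coefs a j.+1)`_j.
pose g r := if pselect (exists j, r = grid n (- m') j) is left e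
            then b (projT1 (cid e)) else 0.
have gS : series_from n (- m') g.
  by move=> r; rewrite /g; case: pselect => // _; rewrite eqxx.
have gE j : g (grid n (- m') j) = b j.
  rewrite /g; case: pselect => [e|[]]; last by exists j.
  by case: cid => i /= /(grid_inj n0) ->.
have gP := series_from_puiseux n0 gS.
exists g => //; rewrite convC//.
apply: (series_ext (n := n) (m := m' - m')) => [||l].
- exact: series_from_conv.
- by rewrite subrr; exact: one_seriesS.
rewrite grid_convE// subrr one_series_grid// -(inv_coefsE l a0).
by apply: eq_bigr => i _; rewrite gE.
Qed.

End Series.

Section PuiseuxField.

Variable F : fieldType.

Record puiseux := Puiseux {
  coefs :> rat -> F;
  coefsP : coefs \in @puiseux_series F }.

HB.instance Definition _ := [isSub for coefs].
HB.instance Definition _ := [Choice of puiseux by <:].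
HB.instance Definition _ := [SubChoice_isSubZmodule of puiseux by <:].

Definition puiseux1 : puiseux :=
  Puiseux (series_from_puiseux (ltn0Sn 0) (@one_seriesS F 1)).

Definition puiseux_mul (x y : puiseux) : puiseux :=
  Puiseux (puiseux_conv (coefsP x) (coefsP y)).

Fact puiseux_mulA : associative puiseux_mul.
Proof. by move=> x y z; apply/val_inj/convA; exact: coefsP. Qed.

Fact puiseux_mulC : commutative puiseux_mul.
Proof. by move=> x y; apply/val_inj/convC; exact: coefsP. Qed.

Fact puiseux_mul1 : left_id puiseux1 puiseux_mul.
Proof. by move=> x; apply/val_inj/conv1; exact: coefsP. Qed.

Fact puiseux_mulDl : left_distributive puiseux_mul +%R.
Proof. by move=> x y z; apply/val_inj/convDl; exact: coefsP. Qed.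

Fact puiseux1_neq0 : puiseux1 != 0.
Proof.
apply/eqP => /(congr1 (fun x : puiseux => x 0)) /=.
by rewrite /one_series eqxx => /eqP; rewrite oner_eq0.
Qed.

HB.instance Definition _ := GRing.Zmodule_isComNzRing.Build puiseux
  puiseux_mulA puiseux_mulC puiseux_mul1 puiseux_mulDl puiseux1_neq0.

Fact puiseux_inv_ex (x : puiseux) :
  exists y : puiseux, if x == 0 then y = 0 else y * x = 1.
Proof.
have [_|x0] := eqVneq x 0; first by exists 0.
have [g gP gx] := conv_inv_ex (coefsP x) x0.
by exists (Puiseux gP); apply/val_inj.
Qed.

Definition puiseux_inv (x : puiseux) : puiseux := projT1 (cid (puiseux_inv_ex x)).

Fact puiseux_mulV (x : puiseux) : x != 0 -> puiseux_inv x * x = 1.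
Proof. by rewrite /puiseux_inv; case: cid => y /=; case: eqP. Qed.

Fact puiseux_inv0 : puiseux_inv 0 = 0.
Proof. by rewrite /puiseux_inv; case: cid => y /=; rewrite eqxx. Qed.

HB.instance Definition _ :=
  GRing.ComNzRing_isField.Build puiseux puiseux_mulV puiseux_inv0.

Definition puiseux_integers : set puiseux :=
  [set x | exists2 n, (0 < n)%N & power_series n x].

End PuiseuxField.

Arguments puiseux_integers F : clear implicits.

(* Main.v *)
(* A Puiseux series w is integral iff it satisfies
     exists x z, z^q = z /\ (w - z) (x^q - x + 1) = 1.
   Since X^q - X + 1 takes the value 1 on all of F_q, no x^q - x + 1 has
   positive valuation, so w - z is integral, and z^q = z forces z integral.
   Conversely, take z = w(0) - 1, so that (w - z)^-1 - 1 =: y has positive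
   valuation; then x^q - x = y is solved by x = - (y + y^q + y^(q^2) + ...),
   whose coefficients are explicit because the q-th power map only dilates
   exponents. *)
Require Import Defs.
From mathcomp Require Import all_boot all_order all_algebra all_field.
From mathcomp Require Import boolp classical_sets functions fsbigop.

Set Implicit Arguments.
Unset Strict Implicit.
Unset Printing Implicit Defensive.

Import Order.TTheory GRing.Theory Num.Theory.

Local Open Scope ring_scope.

(** * Supports bounded below and leading coefficients *)

Section Order.

Variable F : fieldType.
Implicit Types (x y : puiseux F) (r s : rat).

(** The [t]-adic valuation of [x] is at least [r], put so that 0 needs no valuation. Together with
    [x r != 0] it makes the valuation exactly [r]. *)
Definition zero_below r x := forall s, s < r -> x s = 0.

Lemma coef_puiseuxD x y r : (x + y) r = x r + y r. Proof. by []. Qed.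

Lemma coef_puiseuxB x y r : (x - y) r = x r - y r. Proof. by []. Qed.

Lemma coef_puiseuxM x y r : (x * y) r = conv x y r. Proof. by []. Qed.

Lemma coef_puiseux1 r : (1 : puiseux F) r = (r == 0)%:R. Proof. by []. Qed.

Lemma zero_below1 : zero_below 0 1.
Proof. by move=> s s0; rewrite coef_puiseux1 lt_eqF. Qed.

Lemma zero_belowW r s x : s <= r -> zero_below r x -> zero_below s x.
Proof. by move=> sr xr a /lt_le_trans/(_ sr)/xr. Qed.

Lemma zero_belowD r x y :
  zero_below r x -> zero_below r y -> zero_below r (x + y).
Proof. by move=> xr yr s sr; rewrite coef_puiseuxD xr// yr// addr0. Qed.

Lemma zero_belowB r x y :
  zero_below r x -> zero_below r y -> zero_below r (x - y).
Proof. by move=> xr yr s sr; rewrite coef_puiseuxB xr// yr// subr0. Qed.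

Lemma zero_belowM r s x y :
  zero_below r x -> zero_below s y -> zero_below (r + s) (x * y).
Proof.
move=> xr ys a ars; rewrite coef_puiseuxM /conv fsbig1// => b _.
have [br|rb] := ltP b r; first by rewrite xr// mul0r.
by rewrite ys ?mulr0// ltrBlDl (lt_le_trans ars)// lerD2r.
Qed.

(** Only the term at exponent [r] of the convolution survives: below it [x] vanishes, above it [y]
    does. *)
Lemma coef_low_mul r s x y : zero_below r x -> zero_below s y ->
  (x * y) (r + s) = x r * y s.
Proof.
move=> xr ys; rewrite coef_puiseuxM /conv.
rewrite (@fsbigE _ _ _ _ _ [:: r])//; last first.
  move=> a _; rewrite inE; have [ar _|ra _|->//] := ltgtP a r.
    by rewrite xr// mul0r.
  by rewrite ys ?mulr0// ltrBlDl ltrD2r.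
rewrite big_mkcond big_seq1 in_setT.
by rewrite addrC addKr.
Qed.

Lemma zero_belowX r x n : zero_below r x -> zero_below (r *+ n) (x ^+ n).
Proof.
move=> xr; elim: n => [|n IH]; first exact: zero_below1.
by rewrite exprS mulrS; exact: zero_belowM.
Qed.

Lemma coef_low_exp r x n : zero_below r x -> (x ^+ n) (r *+ n) = x r ^+ n.
Proof.
move=> xr; elim: n => [|n IH]; first by rewrite coef_puiseux1 eqxx.
rewrite !exprS mulrS coef_low_mul ?IH//; exact: zero_belowX.
Qed.

(** The support lies on a grid indexed by the naturals, so it has a least element. *)
Lemma order_ex x : x != 0 -> exists2 r, x r != 0 & zero_below r x.
Proof.
move=> x0; have /asboolP[n n0 [m xS]] := coefsP x.
have ex_nz : exists k, x (grid n m k) != 0.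
  apply: contrapT => nz; move/eqP: x0; apply; apply/val_inj/funext => r.
  have [//|xr] := eqVneq (x r) 0; case: nz.
  by have [k rk] := xS _ xr; exists k; rewrite -rk.
have [k xk kmin] := ex_minnP ex_nz; exists (grid n m k) => // s sk.
apply/eqP; apply: contraTT sk => /[dup] xs /xS[j sj]; rewrite -leNgt sj.
rewrite /grid ler_pM2r ?invr_gt0 ?ltr0n// ler_int lerD2l lez_nat.
by apply: kmin; rewrite -sj.
Qed.

Lemma order_uniq r s x :
  x r != 0 -> zero_below r x -> x s != 0 -> zero_below s x -> r = s.
Proof.
move=> xr rx xs sx; apply/eqP; rewrite eq_le !leNgt.
by apply/andP; split; apply/negP; [move=> /rx|move=> /sx]; apply/eqP.
Qed.

(** The product of the leading coefficients is the leading coefficient of 1, so the two orders sum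
    to 0. *)
Lemma order_mul_eq1 x y r : x * y = 1 -> x r != 0 -> zero_below r x ->
  y (- r) != 0 /\ zero_below (- r) y.
Proof.
move=> xy xr rx.
have y0 : y != 0.
  by apply/eqP => y0; move/eqP: xy; rewrite y0 mulr0 eq_sym oner_eq0.
have [s ys sy] := order_ex y0.
suff <- : s = - r by [].
have h := coef_low_mul rx sy.
apply/eqP; rewrite -addr_eq0 addrC; apply/eqP.
apply: (@order_uniq _ _ (1 : puiseux F)); last exact: zero_below1.
- by rewrite -xy h mulf_neq0.
- by rewrite -xy; exact: zero_belowM.
- by rewrite coef_puiseux1 eqxx oner_neq0.
Qed.

Lemma puiseux_integersP x : puiseux_integers F x <-> zero_below 0 x.
Proof.
split=> [[n n0 xS] r r0|x0].
  apply/eqP; apply: contraTT r0 => /xS[k ->]; rewrite -leNgt.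
  by rewrite /grid add0r divr_ge0// ler0n.
have /asboolP[n n0 [m xS]] := coefsP x; exists n => // r /[dup] xr /xS[k rE].
have : 0 <= r by rewrite leNgt; apply: contra_neqN xr; exact: x0.
rewrite rE /grid pmulr_lge0 ?invr_gt0 ?ltr0n// ler0z => mk0.
(* Even if [m < 0], a nonnegative exponent [(m + k) / n] lies on the grid of the same [n] starting
   at 0. *)
by exists (absz (m + k%:Z)); rewrite add0r gez0_abs.
Qed.

(** * Power series on a fixed grid and their coefficient sequences *)

Lemma power_series_ex n (b : nat -> F) : (0 < n)%N ->
  exists2 x : puiseux F, power_series n x & forall k, x (grid n 0 k) = b k.
Proof.
move=> n0; pose g r :=
  if pselect (exists j, r = grid n 0 j) is left e
  then b (projT1 (cid e)) else 0.
have gS : series_from n 0 g.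
  by move=> r; rewrite /g; case: pselect => // _; rewrite eqxx.
exists (Puiseux (series_from_puiseux n0 gS)) => // k.
rewrite /= /g; case: pselect => [e|[]]; last by exists k.
by case: cid => i /= /(grid_inj n0) ->.
Qed.

Lemma power_seriesX n x j : power_series n x -> power_series n (x ^+ j).
Proof.
move=> xS; elim: j => [|j IH]; first exact: one_seriesS.
by rewrite exprS; exact: (series_from_conv xS IH).
Qed.

Lemma power_seriesB n x y :
  power_series n x -> power_series n y -> power_series n (x - y).
Proof.
move=> xS yS r; rewrite coef_puiseuxB.
by have [->|/xS//] := eqVneq (x r) 0; rewrite add0r oppr_eq0 => /yS.
Qed.

(** A coefficient of a power depends only on coefficients of [x] up to the same index; this carries
    polynomial identities over to series. *)
Lemma coef_exp_trunc n x j k N : (0 < n)%N -> power_series n x -> (k < N)%N ->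
  (x ^+ j) (grid n 0 k) = ((\poly_(i < N) x (grid n 0 i)) ^+ j)`_k.
Proof.
move=> n0 xS; elim: j k => [|j IH] k kN.
  by rewrite expr0 coef1; exact: one_series_grid.
rewrite !exprS coefM coef_puiseuxM -[in LHS](addr0 (0 : int)).
rewrite (grid_convE k n0 xS (power_seriesX xS)); apply: eq_bigr => i _.
rewrite coef_poly (leq_trans (ltn_ord i) kN) IH//.
exact: leq_ltn_trans (leq_subr _ _) kN.
Qed.

End Order.

(** * The [q]-th power map and the Artin-Schreier equation *)

Section FiniteField.

Variable F : finFieldType.
Implicit Types (P : {poly F}) (w x y z : puiseux F).
Local Notation q := #|F|.
Hypothesis pcharq : [pchar F].-nat q.

Let q_gt1 : (1 < q)%N := finNzRing_gt1 F.

Let q_gt0 : (0 < q)%N := ltnW q_gt1.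

(** The [q]-th power is additive, [q] being a power of the characteristic, and it fixes every
    coefficient in [F]. *)
Lemma poly_exp_card P : P ^+ q = P \Po 'X^q.
Proof.
have polyq : [pchar {poly F}].-nat q by rewrite (eq_pnat _ (pchar_poly F)).
elim/poly_ind: P => [|P c IH].
  by rewrite comp_poly0 expr0n gtn_eqF.
rewrite exprDn_pchar// exprMn IH -polyC_exp expf_card.
by rewrite comp_polyD comp_polyM comp_polyX comp_polyC.
Qed.

Lemma coef_exp_card n x k : (0 < n)%N -> power_series n x ->
  (x ^+ q) (grid n 0 k) = if (q %| k)%N then x (grid n 0 (k %/ q)%N) else 0.
Proof.
move=> n0 xS; rewrite (coef_exp_trunc _ n0 xS (ltnSn k)) poly_exp_card.
by rewrite coef_comp_poly_Xn// coef_poly ltnS leq_div.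
Qed.

Lemma constant_ex (c : F) : exists z, [/\ z ^+ q = z, zero_below 0 z & z 0 = c].
Proof.
have [z zS zE] := power_series_ex (fun k => if k is 0 then c else 0) (ltn0Sn 0).
exists z; split.
- apply/val_inj/(series_ext (power_seriesX zS) zS) => k.
  rewrite (coef_exp_card _ _ zS)// !zE; case: k => [|k].
    by rewrite dvdn0 div0n.
  case: ifP => // /divnK; case: (_ %/ _)%N => //.
- by apply/puiseux_integersP; exists 1%N.
- by rewrite -(zE 0%N) /grid addr0 mul0r.
Qed.

(** Comparing coefficients in [x ^+ q - x = y] gives x_k = x_(k/q) - a_k, the first term present
    only if [q] divides [k]. The argument [m] is fuel; once [a 0 = 0], any [m > k] gives the same
    value. *)
Fixpoint artin_schreier_coefs (a : nat -> F) (m k : nat) : F :=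
  if m is m'.+1 then
    (if (q %| k)%N then artin_schreier_coefs a m' (k %/ q)%N else 0) - a k
  else 0.

Lemma artin_schreier_coefs0 a m : a 0%N = 0 -> artin_schreier_coefs a m 0 = 0.
Proof. by move=> a0; elim: m => //= m IH; rewrite dvdn0 div0n IH a0 subr0. Qed.

Lemma artin_schreier_coefs_fuel a m m' k : a 0%N = 0 -> (k < m)%N ->
  (k < m')%N -> artin_schreier_coefs a m k = artin_schreier_coefs a m' k.
Proof.
move=> a0; elim: m m' k => // m IH [//|m'] [|k] km km'.
  by rewrite !artin_schreier_coefs0.
rewrite /=; case: ifP => // _; congr (_ - _).
by apply: IH; [move: km|move: km']; rewrite ltnS; apply: leq_trans;
  exact: ltn_Pdiv.
Qed.

Lemma artin_schreier_ex y : zero_below 0 y -> y 0 = 0 ->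
  exists x, x ^+ q - x = y.
Proof.
move=> /puiseux_integersP[n n0 yS] y0; pose a k := y (grid n 0 k).
have a0 : a 0%N = 0 by rewrite /a /grid addr0 mul0r.
have [x xS xE] :=
  power_series_ex (fun k => artin_schreier_coefs a k.+1 k) n0.
exists x; apply/val_inj/(series_ext _ yS) => [|k].
  by apply: power_seriesB => //; exact: power_seriesX.
rewrite [LHS]coef_puiseuxB coef_exp_card// !xE [in X in _ - X]/= opprB addrCA.
case: ifP => [qk|_]; last by rewrite subr0 addr0.
(* One unfolding leaves [a k] plus a difference of values at [k %/ q] with fuels [(k %/ q).+1] and
   [k]. The latter suffices only for [k > 0]; at 0 both values vanish. *)
have [->|k0] := posnP k.
  by rewrite div0n !artin_schreier_coefs0// subrr addr0.
rewrite (@artin_schreier_coefs_fuel _ _ k)//; first by rewrite subrr addr0.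
exact: ltn_Pdiv.
Qed.

(** For integral [x] the constant coefficient is 1, as c^q = c in [F]. If [x] has order [r < 0],
    then [x ^+ q] dominates, with order [r *+ q < r]. *)
Lemma exp_card_low x : exists2 r, r <= 0 & (x ^+ q - x + 1) r != 0.
Proof.
have coefE r : (x ^+ q - x + 1) r = (x ^+ q) r - x r + (r == 0)%:R by [].
have [x0|x0] := pselect (zero_below 0 x).
  exists 0 => //; rewrite coefE -[X in (x ^+ q) X](mul0rn _ q).
  by rewrite coef_low_exp// expf_card subrr add0r eqxx oner_neq0.
have [|r xr rx] := @order_ex _ x.
  by apply: contra_notN x0 => /eqP ->.
have r0 : r < 0.
  by rewrite ltNge; apply/negP => r0; apply: x0; exact: zero_belowW rx.
have rq : r *+ q < r.
  by rewrite -subr_lt0 -{2}[r]mulr1n -mulrnBr // pmulrn_llt0 ?subn_gt0.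
exists (r *+ q); first by rewrite pmulrn_lle0 ?ltW.
rewrite coefE coef_low_exp// expf_card (rx _ rq).
by rewrite subr0 (lt_eqF (lt_trans rq r0)) addr0.
Qed.

(** Equating the orders of [z ^+ q] and [z] gives [r *+ q = r], which forces [r = 0]. *)
Lemma zero_below_exp_card z : z ^+ q = z -> zero_below 0 z.
Proof.
move=> zq; have [-> //|/order_ex[r zr rz]] := eqVneq z 0.
suff r0 : r = 0 by rewrite -r0.
have : r *+ q = r.
  apply: (@order_uniq _ _ _ z) => //.
    by rewrite -zq coef_low_exp// expf_card.
  by rewrite -zq; exact: zero_belowX.
move/eqP; rewrite -subr_eq0 -{2}[r]mulr1n -mulrnBr// mulrn_eq0 subn_eq0.
by rewrite leqNgt q_gt1 => /eqP.
Qed.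

(** * The existential criterion for integrality *)

Lemma puiseux_integers_ex w : puiseux_integers F w <->
  exists x z, z ^+ q = z /\ (w - z) * (x ^+ q - x + 1) = 1.
Proof.
rewrite puiseux_integersP; split=> [w0|[x [z [/zero_below_exp_card z0 wz]]]].
  have [z [zq z0 zw]] := constant_ex (w 0 - 1).
  have u0 : zero_below 0 (w - z) by exact: zero_belowB.
  have u1 : (w - z) 0 = 1 by rewrite coef_puiseuxB zw subKr.
  have nz : w - z != 0.
    by apply: contraPneq u1 => -> /esym/eqP; rewrite (negPf (oner_neq0 _)).
  have [|_ v0] := order_mul_eq1 (mulfV nz) _ u0; first by rewrite u1 oner_neq0.
  rewrite oppr0 in v0.
  have v1 : (w - z)^-1 0 = 1.
    have := coef_low_mul u0 v0.
    by rewrite addr0 mulfV// u1 mul1r coef_puiseux1 eqxx.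
  have [||x xE] := @artin_schreier_ex ((w - z)^-1 - 1).
  - by apply: zero_belowB => //; exact: zero_below1.
  - by rewrite coef_puiseuxB v1 coef_puiseux1 eqxx subrr.
  by exists x, z; split=> //; rewrite xE subrK mulfV.
rewrite -[w](subrK z); apply: zero_belowD => //.
(* If [w - z] has order [r], its cofactor has order [- r]; a nonzero coefficient of the cofactor at
   some [s <= 0] gives [- r <= s <= 0]. *)
have [|r ur ru] := @order_ex _ (w - z).
  by apply: contra_eq_neq wz => ->; rewrite mul0r eq_sym oner_neq0.
have [_ low] := order_mul_eq1 wz ur ru.
have [s s0 fs] := exp_card_low x.
apply: zero_belowW ru; rewrite -oppr_le0; apply: le_trans s0.
by rewrite leNgt; apply: contra fs => /low ->.
Qed.

End FiniteField.

Theorem theorem3p1 (q : nat)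
    (hq : exists p k : nat, [/\ prime p, (0 < k)%N & q = (p ^ k)%N])
    (F : finFieldType) (hF : #|F| = q) :
  ex_emptyset_definable (puiseux_integers F).
Proof.
have pcharq : [pchar F].-nat #|F|.
  have [p [k [p_pr _ qE]]] := hq; have FE : #|F| = (p ^ k)%N by rewrite hF.
  rewrite (eq_pnat _ (pcharf_eq (card_finPcharP FE p_pr))) FE.
  by rewrite pnatX pnat_id.
pose X i : GRing.term (puiseux F) := GRing.Var _ i.
(* Variable 0 is [w], 1 is [x] and 2 is [z]. The exponent is a fixed natural number and the only
   constant is the numeral 1, so no parameter occurs. *)
pose f : GRing.formula (puiseux F) := GRing.Exists 1 (GRing.Exists 2
  (GRing.And (GRing.Equal (GRing.Exp (X 2) #|F|) (X 2))
    (GRing.Equal (GRing.Mul (GRing.Add (X 0) (GRing.Opp (X 2)))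
       (GRing.Add (GRing.Add (GRing.Exp (X 1) #|F|) (GRing.Opp (X 1)))
                  (GRing.NatConst _ 1)))
      (GRing.NatConst _ 1)))).
exists f; split=> //.
by apply/seteqP; split=> w; rewrite /= (puiseux_integers_ex pcharq).
Qed.
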